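(* Let $\mathcal{X}^-$ be the nonsymmetric operad over $\mathbb{Q}$ generated by four binary operations $x,y,z,t$ subject to the sixteen quadratic relations listed in the context (with the sign $-$ in relation (16)), and let $\mathcal{X}^-_n$ denote its component of arity $n$. Then for all integers $n\ge 1$ with $n\neq 3$, $$\dim_{\mathbb{Q}}\mathcal{X}^-_n=\binom{2n}{n-1}.$$
   Context: Let $k$ be a field (in the claim, $k=\mathbb{Q}$). The free nonsymmetric operad $\mathcal{T}$ over $k$ on four binary operations $x,y,z,t$ has as its arity $n$ component $\mathcal{T}_n$ ($n\ge 1$) the $k$-vector space with basis all planar rooted binary trees with $n$ leaves whose $n-1$ internal vertices are labelled by elements of $\{x,y,z,t\}$. Equivalently, the basis consists of all fully parenthesized monomials in the operations $x,y,z,t$ in which the arguments $a_1,\dots,a_n$ occur exactly once each, in this order; for $n=1$ the only basis element is the identity operation. Operadic composition is grafting of trees. There is no action of symmetric groups. For a choice of sign $\pm$, the operad $\mathcal{X}^{\pm}$ over $k$ is the quotient of $\mathcal{T}$ by the operadic ideal generated by the following sixteen relations of arity three (each relation ''$L=R$'' means that $L-R$ is a generator of the ideal): (1) $x(x(a_1,a_2),a_3)=x(a_1,x(a_2,a_3))+x(a_1,t(a_2,a_3))$, (2) $x(x(a_1,a_2),a_3)=x(a_1,y(a_2,a_3))+x(a_1,z(a_2,a_3))$, (3) $x(z(a_1,a_2),a_3)=z(a_1,x(a_2,a_3))+z(a_1,t(a_2,a_3))$, (4) $z(x(a_1,a_2),a_3)=z(a_1,z(a_2,a_3))+z(a_1,y(a_2,a_3))$,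 (5) $z(z(a_1,a_2),a_3)=z(a_1,z(a_2,a_3))+z(a_1,y(a_2,a_3))$, (6) $x(t(a_1,a_2),a_3)=t(a_1,x(a_2,a_3))$, (7) $x(t(a_1,a_2),a_3)=t(a_1,z(a_2,a_3))$, (8) $x(y(a_1,a_2),a_3)=y(a_1,x(a_2,a_3))$, (9) $z(t(a_1,a_2),a_3)=y(a_1,z(a_2,a_3))$, (10) $z(y(a_1,a_2),a_3)=y(a_1,z(a_2,a_3))$, (11) $t(x(a_1,a_2),a_3)+t(t(a_1,a_2),a_3)=t(a_1,t(a_2,a_3))$, (12) $t(x(a_1,a_2),a_3)+t(t(a_1,a_2),a_3)=t(a_1,y(a_2,a_3))$, (13) $t(z(a_1,a_2),a_3)+t(y(a_1,a_2),a_3)=y(a_1,t(a_2,a_3))$, (14) $y(x(a_1,a_2),a_3)+y(t(a_1,a_2),a_3)=y(a_1,y(a_2,a_3))$, (15) $y(z(a_1,a_2),a_3)+y(y(a_1,a_2),a_3)=y(a_1,y(a_2,a_3))$, (16) $y(z(a_1,a_2),a_3)-y(x(a_1,a_2),a_3)=\pm\bigl(x(a_1,t(a_2,a_3))-x(a_1,y(a_2,a_3))\bigr)$. The operad $\mathcal{X}^+$ is obtained with the sign $+$ in (16), and $\mathcal{X}^-$ with the sign $-$ in (16). The arity $n$ component of the quotient is denoted $\mathcal{X}^{\pm}_n$. *)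

(* Defs.v *)
From HB Require Import structures.
From mathcomp Require Import all_boot all_order all_algebra.
From mathcomp Require Import boolp.

Set Implicit Arguments.
Unset Strict Implicit.
Unset Printing Implicit Defensive.

Import GRing.Theory.
Local Open Scope ring_scope.
Local Open Scope quotient_scope.

(* The quotient V / S of a finite-dimensional space by a linear subspace.     *)
(* The library makes Quotient.quot S an additive group; scalars and finite    *)
(* dimension are added here. S is a boolean predicate closed under linear     *)
(* combinations rather than a {vspace V}, so that an ideal defined in Prop    *)
(* can be used directly.                                                      *)

(* submodClosed, being meant for semimodules, does not come with closure      *)
(* under opposites; over a ring it follows from closure under scaling.        *)
Definition quotv_ker (K : fieldType) (V : vectType K) (S : submodClosed V) :
  {pred V} := S.

Fact quotv_ker_zmod K V S : zmod_closed (@quotv_ker K V S).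
Proof.
split=> [|v w vS wS]; first exact: (rpred0 S).
by rewrite -scaleN1r; apply: (rpredD vS); apply: rpredZ.
Qed.

HB.instance Definition _ (K : fieldType) (V : vectType K) (S : submodClosed V) :=
  GRing.isZmodClosed.Build V (@quotv_ker K V S) (quotv_ker_zmod S).

Definition quotv (K : fieldType) (V : vectType K) (S : submodClosed V) : Type :=
  Quotient.quot (quotv_ker S).

HB.instance Definition _ (K : fieldType) (V : vectType K) (S : submodClosed V) :=
  GRing.Zmodule.on (@quotv K V S).

Section QuotientSpace.
Variables (K : fieldType) (V : vectType K) (S : submodClosed V).
Local Notation Q := (quotv S).

Definition quotv_pi (v : V) : Q := \pi_(Quotient.quot (quotv_ker S)) v.

Let quotv_repr (q : Q) : V := repr (q : Quotient.quot (quotv_ker S)).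

Let quotv_piK q : quotv_pi (quotv_repr q) = q.
Proof. exact: reprK. Qed.

Lemma quotv_pi_eq v w : (quotv_pi v == quotv_pi w) = (v - w \in S).
Proof. by rewrite -[RHS]/(v - w \in quotv_ker S) Quotient.idealrBE. Qed.

Let quotv_piD v w : quotv_pi (v + w) = quotv_pi v + quotv_pi w.
Proof. exact: (raddfD (\pi_(Quotient.quot (quotv_ker S)))). Qed.

Definition quotv_scale (a : K) (q : Q) : Q := quotv_pi (a *: quotv_repr q).

Let quotv_scaleE a v : quotv_scale a (quotv_pi v) = quotv_pi (a *: v).
Proof.
apply/eqP; rewrite quotv_pi_eq -scalerBr rpredZ // -quotv_pi_eq.
by rewrite quotv_piK.
Qed.

Fact quotv_scaleA a b q :
  quotv_scale a (quotv_scale b q) = quotv_scale (a * b) q.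
Proof. by rewrite -[q]quotv_piK !quotv_scaleE scalerA. Qed.

Fact quotv_scale1 : left_id 1 quotv_scale.
Proof. by move=> q; rewrite -[q]quotv_piK quotv_scaleE scale1r. Qed.

Fact quotv_scaleDr : right_distributive quotv_scale +%R.
Proof.
move=> a p q; rewrite -[p]quotv_piK -[q]quotv_piK -quotv_piD !quotv_scaleE.
by rewrite scalerDr quotv_piD.
Qed.

Fact quotv_scaleDl q : {morph quotv_scale^~ q : a b / a + b}.
Proof.
by move=> a b; rewrite -[q]quotv_piK !quotv_scaleE scalerDl quotv_piD.
Qed.

HB.instance Definition _ := GRing.Zmodule_isLmodule.Build K Q
  quotv_scaleA quotv_scale1 quotv_scaleDr quotv_scaleDl.

Fact quotv_pi_linear : linear quotv_pi.
Proof. by move=> a v w; rewrite quotv_piD -quotv_scaleE. Qed.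

HB.instance Definition _ := GRing.isLinear.Build K V Q _ quotv_pi quotv_pi_linear.

Fact quotv_subspace : exists U : {vspace V}, forall v, (v \in U) = (v \in S).
Proof.
pose P d := `[< exists2 U : {vspace V}, \dim U = d & {subset U <= S} >].
have exP : exists d, P d.
  exists 0%N; apply/asboolP; exists 0%VS; first by rewrite dimv0.
  by move=> v; rewrite memv0 => /eqP->; rewrite rpred0.
have leP d : P d -> (d <= \dim {:V})%N.
  by case/asboolP=> U <- _; rewrite dimvS ?subvf.
case: (ex_maxnP exP leP) => d /asboolP[U dU US] maxd.
exists U => v; apply/idP/idP=> [/US//|vS].
have UvS : {subset (U + <[v]>)%VS <= S}.
  move=> _ /memv_addP[u /US uS [_ /vlineP[a ->] ->]].
  by rewrite rpredD ?rpredZ.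
have /maxd : P (\dim (U + <[v]>)%VS) by apply/asboolP; exists (U + <[v]>)%VS.
rewrite -dU => le_dim.
have /eqP-> : (U == U + <[v]>)%VS by rewrite eqEdim addvSl.
by rewrite (subvP (addvSr _ _)) ?memv_line.
Qed.

Fact quotv_finDim : {n : nat & Vector.axiom n Q}.
Proof.
have [U US] := cid quotv_subspace.
pose f v := vsproj U^C%VS (daddv_pi U^C%VS U v).
have f_ker v : (f v == 0) = (v \in S).
  have cap0 : (U^C :&: U = 0)%VS by rewrite capvC capv_compl.
  have dv : v = daddv_pi U^C%VS U v + daddv_pi U U^C%VS v.
    by rewrite daddv_pi_add // addvC addv_complf memvf.
  have fE : vsval (f v) = daddv_pi U^C%VS U v.
    by rewrite vsprojK ?memv_pi.
  rewrite -US -(inj_eq val_inj) /= fE.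
  apply/eqP/idP=> [v0|vU]; first by rewrite dv v0 add0r memv_pi.
  apply/eqP; rewrite -memv0 -cap0 memv_cap memv_pi /=.
  have -> : daddv_pi U^C%VS U v = v - daddv_pi U U^C%VS v.
    by apply/eqP; rewrite eq_sym subr_eq -dv.
  by rewrite memvB ?memv_pi.
have f_lin a v w : f (a *: v + w) = a *: f v + f w by rewrite /f !linearP.
have fB v w : f (v - w) = f v - f w.
  by rewrite addrC -scaleN1r f_lin scaleN1r addrC.
have f_pi v w : (f v == f w) = (quotv_pi v == quotv_pi w).
  by rewrite quotv_pi_eq -f_ker fB subr_eq0.
have [h h_lin h_bij] := subvs_vect_iso U^C%VS.
exists (\dim U^C%VS); exists (fun q => h (f (quotv_repr q))).
  move=> a p q; rewrite -h_lin -f_lin; congr h.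
  by apply/eqP; rewrite f_pi quotv_piK quotv_pi_linear !quotv_piK.
case: h_bij => h' hK h'K; exists (fun r => quotv_pi (vsval (h' r))).
  move=> q; rewrite hK -[RHS]quotv_piK; apply/eqP.
  by rewrite -f_pi /f vsprojK ?memv_pi // daddv_pi_proj // capvC capv_compl.
move=> r; rewrite -[RHS]h'K; congr h; set w := h' r.
have fw : f (vsval w) = w.
  by rewrite /f daddv_pi_id ?subvsP ?vsvalK // capvC capv_compl.
by rewrite -[RHS]fw; apply/eqP; rewrite f_pi quotv_piK.
Qed.

HB.instance Definition _ :=
  Lmodule_hasFinDim.Build K Q (projT2 quotv_finDim).

End QuotientSpace.

Inductive op := opx | opy | opz | opt.

Definition op_code (a : op) : 'I_4 :=
  match a with opx => inord 0 | opy => inord 1 | opz => inord 2 | opt => inord 3 end.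

Definition op_decode (i : 'I_4) : op := nth opx [:: opx; opy; opz; opt] i.

Fact op_codeK : cancel op_code op_decode.
Proof. by case; rewrite /op_decode /op_code inordK. Qed.

HB.instance Definition _ := Finite.copy op (can_type op_codeK).

Inductive tree := Leaf | Node of op & tree & tree.

Fixpoint tree_code (t : tree) : GenTree.tree op :=
  match t with
  | Leaf => GenTree.Node 0 [::]
  | Node a l r => GenTree.Node 1 [:: GenTree.Leaf a; tree_code l; tree_code r]
  end.

Fixpoint tree_decode (t : GenTree.tree op) : tree :=
  match t with
  | GenTree.Node 1 [:: GenTree.Leaf a; l; r] =>
      Node a (tree_decode l) (tree_decode r)
  | _ => Leaf
  end.

Fact tree_codeK : cancel tree_code tree_decode.
Proof. by elim=> //= a l -> r ->. Qed.

HB.instance Definition _ := Countable.copy tree (can_type tree_codeK).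

Fixpoint leaves (t : tree) : nat :=
  if t is Node _ l r then leaves l + leaves r else 1.

(* graft s i t replaces the leaf number i of s by t; leaves are numbered from *)
(* left to right starting at 0.                                               *)
Fixpoint graft (s : tree) (i : nat) (t : tree) : tree :=
  match s with
  | Leaf => t
  | Node a l r => if (i < leaves l)%N then Node a (graft l i t) r
                  else Node a l (graft r (i - leaves l) t)
  end.

Lemma leaves_gt0 t : (0 < leaves t)%N.
Proof. by elim: t => //= a l IHl r _; rewrite addn_gt0 IHl. Qed.

Lemma leaves_graft s i t : (i < leaves s)%N ->
  leaves (graft s i t) = (leaves s + leaves t).-1.
Proof.
elim: s i => [|a l IHl r IHr] i /= lt_i; first by [].
have l0 := leaves_gt0 l; have r0 := leaves_gt0 r; have t0 := leaves_gt0 t.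
case: ltnP => /= le_i.
  by rewrite IHl // -(prednK t0) !addnS /= addnAC.
by rewrite IHr ?ltn_subLR // -(prednK t0) !addnS /= addnA.
Qed.

Definition ntree (n : nat) : Type := {t : tree | leaves t == n}.

HB.instance Definition _ n := SubCountable.on (ntree n).

(* All trees of height less than h. *)
Fixpoint trees_upto (h : nat) : seq tree :=
  if h is h'.+1 then
    Leaf :: flatten [seq [seq Node a l r | l <- trees_upto h', r <- trees_upto h']
                    | a <- [:: opx; opy; opz; opt]]
  else [::].

Fact mem_trees_upto t h : (leaves t <= h)%N -> t \in trees_upto h.
Proof.
elim: t h => [|a l IHl r IHr] [|h] //=.
  by rewrite leqNgt addn_gt0 leaves_gt0.
have l0 := leaves_gt0 l; have r0 := leaves_gt0 r.
move=> le_h; rewrite in_cons !mem_cat; apply/orP; right.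
suff: Node a l r \in [seq Node a l1 r1 | l1 <- trees_upto h, r1 <- trees_upto h].
  by case: (a) => ->; rewrite ?orbT.
apply/allpairsP; exists (l, r); split=> //=.
  by apply: IHl; rewrite -ltnS; apply: leq_trans le_h; rewrite -addn1 leq_add2l.
by apply: IHr; rewrite -ltnS; apply: leq_trans le_h; rewrite -add1n leq_add2r.
Qed.

Section NtreeFinite.
Variable n : nat.

Definition ntree_enum : seq (ntree n) := undup (pmap insub (trees_upto n)).

Fact ntree_enumP : Finite.axiom ntree_enum.
Proof.
apply: Finite.uniq_enumP; first exact: undup_uniq.
move=> t; rewrite mem_undup mem_pmap_sub mem_trees_upto //.
by rewrite (eqP (valP t)).
Qed.

HB.instance Definition _ := isFinite.Build (ntree n) ntree_enumP.
End NtreeFinite.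

(* The component of arity n of the free nonsymmetric operad: the vector space *)
(* with basis ntree n (the zero space for n = 0, as no tree has 0 leaves).    *)
Definition free_op (K : fieldType) (n : nat) : Type := {ffun ntree n -> K^o}.

HB.instance Definition _ K n := Vector.on (@free_op K n).

Section Operad.
Variable K : fieldType.

Definition monomial n (t : tree) : free_op K n := [ffun u => (val u == t)%:R].

(* The partial composition f o_i g: the bilinear extension of grafting. The   *)
(* sum over ntree n keeps only the trees t such that s o_i t is u.            *)
Definition partial_comp m n (f : free_op K m) (i : 'I_m) (g : free_op K n) :
    free_op K (m + n).-1 :=
  [ffun u => \sum_(s : ntree m) \sum_(t : ntree n |
                graft (val s) i (val t) == val u) (f s : K) * (g t : K)].

Record operadic_ideal (I : forall n, free_op K n -> Prop) : Prop := {
  ideal0 : forall n, I n 0;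
  idealP : forall n (a : K) (f g : free_op K n), I n f -> I n g -> I n (a *: f + g);
  ideal_compl : forall m n (f : free_op K m) (i : 'I_m) (g : free_op K n),
    I m f -> I (m + n).-1 (partial_comp f i g);
  ideal_compr : forall m n (f : free_op K m) (i : 'I_m) (g : free_op K n),
    I n g -> I (m + n).-1 (partial_comp f i g)
}.

Definition generated_ideal (R : seq (free_op K 3)) n (f : free_op K n) : Prop :=
  forall I, operadic_ideal I -> (forall r, r \in R -> I 3 r) -> I n f.

Lemma generated_ideal_is_ideal R : operadic_ideal (generated_ideal R).
Proof.
split=> [n I [] //|n a f g If Ig I idI IR|m n f i g If I idI IR|m n f i g If I idI IR].
- by apply: (idealP idI); [exact: If|exact: Ig].
- by apply: (ideal_compl idI); exact: If.
- by apply: (ideal_compr idI); exact: If.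
Qed.

Lemma generated_ideal_gen (R : seq (free_op K 3)) r : r \in R -> generated_ideal R r.
Proof. by move=> rR I _; apply. Qed.

Definition in_ideal (R : seq (free_op K 3)) n : {pred free_op K n} :=
  fun f => `[< generated_ideal R f >].

Fact in_ideal_submod R n : submod_closed (@in_ideal R n).
Proof.
have idI := generated_ideal_is_ideal R.
split; first by apply/asboolP; exact: (ideal0 idI).
move=> a f g /asboolP If /asboolP Ig; apply/asboolP.
exact: (idealP idI).
Qed.

HB.instance Definition _ R n :=
  GRing.isSubmodClosed.Build K (free_op K n) (@in_ideal R n) (in_ideal_submod R n).

(* lmon a b = a(b(a1, a2), a3) and rmon a b = a(a1, b(a2, a3)). *)
Definition lmon (a b : op) : free_op K 3 :=
  monomial 3 (Node a (Node b Leaf Leaf) Leaf).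
Definition rmon (a b : op) : free_op K 3 :=
  monomial 3 (Node a Leaf (Node b Leaf Leaf)).

Local Notation x := opx.
Local Notation y := opy.
Local Notation z := opz.
Local Notation t := opt.
Local Notation L := lmon.
Local Notation R := rmon.

(* The scalar e, 1 or -1, is the sign of the last relation. *)
Definition relators (e : K) : seq (free_op K 3) :=
  [:: L x x - (R x x + R x t);
      L x x - (R x y + R x z);
      L x z - (R z x + R z t);
      L z x - (R z z + R z y);
      L z z - (R z z + R z y);
      L x t - R t x;
      L x t - R t z;
      L x y - R y x;
      L z t - R y z;
      L z y - R y z;
      L t x + L t t - R t t;
      L t x + L t t - R t y;
      L t z + L t y - R y t;
      L y x + L y t - R y y;
      L y z + L y y - R y y;
      L y z - L y x - e *: (R x t - R x y)].

Definition component (e : K) (n : nat) : vectType K :=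
  quotv (@in_ideal (relators e) n).

End Operad.

Definition Xplus (K : fieldType) (n : nat) : vectType K := component (1 : K) n.
Definition Xminus (K : fieldType) (n : nat) : vectType K := component (-1 : K) n.

(* Main.v *)
(** A tree over x, y, z, t carries two data: its shape, obtained by
    identifying x with z (read "<") and t with y (read ">"), and the leaf
    reached from the root by going left at x, t and right at z, y. Modulo the
    relations with sign -, a tree of arity n <> 3 depends only on this pair, and
    for a fixed leaf the remaining relations are those of dendriform algebras.
    So the component of arity n is n copies of the arity n part of the free
    dendriform algebra on one generator, which has a basis indexed by the binary
    trees with n nodes: the dimension is n times the Catalan number of n.
    The exception in arity 3 is [theta], the image of
    x(a1, t(a2, a3)) - x(a1, y(a2, a3)): it is not zero, but all its proper
    composites are. *)

Require Import Defs.
From HB Require Import structures.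
From mathcomp Require Import all_boot all_order all_algebra.
From mathcomp Require Import boolp.
From mathcomp Require Import lra zify.

Set Implicit Arguments.
Unset Strict Implicit.
Unset Printing Implicit Defensive.

Import Order.TTheory GRing.Theory Num.Theory.
Local Open Scope ring_scope.

Local Notation x := opx.
Local Notation y := opy.
Local Notation z := opz.
Local Notation t := opt.

(** * One-hole contexts and functions on trees compatible with the relations *)

Inductive ctx := Hole | CtxL of op & ctx & tree | CtxR of op & tree & ctx.

Fixpoint plug (F : ctx) (s : tree) : tree :=
  match F with
  | Hole => s
  | CtxL a F r => Node a (plug F s) r
  | CtxR a l F => Node a l (plug F s)
  end.

Lemma leaves_plug F s : leaves (plug F s) = ((leaves (plug F Leaf)).-1 + leaves s)%N.
Proof.
elim: F => //= [o F -> r|o l F ->]; have := leaves_gt0 (plug F Leaf); lia.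
Qed.

(* The sixteen relations, in order, with the sign - in the last one; L o1 o2  *)
(* stands for o1(o2(a1, a2), a3) and R o1 o2 for o1(a1, o2(a2, a3)).          *)
Definition relvals (V : zmodType) (L R : op -> op -> V) : seq V :=
  [:: L x x - (R x x + R x t);
      L x x - (R x y + R x z);
      L x z - (R z x + R z t);
      L z x - (R z z + R z y);
      L z z - (R z z + R z y);
      L x t - R t x;
      L x t - R t z;
      L x y - R y x;
      L z t - R y z;
      L z y - R y z;
      L t x + L t t - R t t;
      L t x + L t t - R t y;
      L t z + L t y - R y t;
      L y x + L y t - R y y;
      L y z + L y y - R y y;
      L y z - L y x + (R x t - R x y)].

(** For [k] past the end of the list, the default value of [nth] makes the condition trivial. *)
Definition satisfies (V : zmodType) (g : tree -> V) := forall a b c k,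
  (relvals (fun o1 o2 => g (Node o1 (Node o2 a b) c))
           (fun o1 o2 => g (Node o1 a (Node o2 b c))))`_k = 0.

(** By [compat_generated_ideal] and [quotv_compat], these are the functions on trees that factor
    through the quotient. The proof works with them, dually, rather than with elements of the
    ideal. *)
Definition compat (V : zmodType) (g : tree -> V) := forall F, satisfies (g \o plug F).

Section Compat.
Variables (V : zmodType) (g : tree -> V).
Hypothesis gP : compat g.

Lemma compat_root : satisfies g.
Proof. exact: (gP Hole). Qed.

Lemma compatL o r : compat (fun s => g (Node o s r)).
Proof. by move=> F; apply: (gP (CtxL o F r)). Qed.

Lemma compatR o l : compat (fun s => g (Node o l s)).
Proof. by move=> F; apply: (gP (CtxR o l F)). Qed.

End Compat.

(** * The exceptional element of arity three *)

(* Beware that relations are numbered from 0: [H a b c k] below is relation   *)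
(* (k + 1) of the list for the arguments a, b, c. The instances used in the   *)
(* lemmas below were found by solving linear systems over the trees with four *)
(* leaves.                                                                    *)
Ltac use E :=
  let e := fresh "e" in pose proof E as e; rewrite /relvals /= in e.

Section RealField.
Variable K : realFieldType.
Implicit Types (g : tree -> K) (a b c d : tree).

(** The last relation equates this with y(x(a, b), c) - y(z(a, b), c), called the second form of
    [theta] below. *)
Definition theta g (a b c : tree) : K :=
  g (Node x a (Node t b c)) - g (Node x a (Node y b c)).

Section Anomaly.
Variable g : tree -> K.
Hypothesis gP : compat g.
Variables a b c d : tree.

Let H := compat_root gP.
Let HL o := compat_root (compatL gP o d).
Let HR o := compat_root (compatR gP o a).

(** Reassociating x(o(a, b), e) gives o(a, x(b, e)), plus, for o = x or z, a term o(a, t(b, e)) that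
    does not distinguish e = t(c, d) from e = y(c, d). *)
Lemma theta_left o :
  theta (fun s => g (Node o a s)) b c d = theta g (Node o a b) c d.
Proof.
rewrite /theta; case: o;
  [use (H a b (Node t c d) 0%N); use (H a b (Node y c d) 0%N);
   use (HR x b c d 10%N); use (HR x b c d 11%N)
  |use (H a b (Node t c d) 7%N); use (H a b (Node y c d) 7%N)
  |use (H a b (Node t c d) 2%N); use (H a b (Node y c d) 2%N);
   use (HR z b c d 10%N); use (HR z b c d 11%N)
  |use (H a b (Node t c d) 5%N); use (H a b (Node y c d) 5%N)]; lra.
Qed.

(** Mirror image of [theta_left], using the second form of [theta]. *)
Lemma theta_right o :
  theta (fun s => g (Node o s d)) a b c = theta g a b (Node o c d).
Proof.
rewrite /theta; case: o;
  [use (H a b (Node x c d) 15%N); use (H (Node x a b) c d 7%N);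
   use (H (Node z a b) c d 7%N); use (HL x a b c 15%N)
  |use (H (Node x a b) c d 14%N); use (H (Node z a b) c d 14%N);
   use (H a b (Node y c d) 15%N); use (HL y a b c 15%N); use (HL y a b c 3%N);
   use (HL y a b c 4%N)
  |use (H (Node x a b) c d 9%N); use (H (Node z a b) c d 9%N);
   use (H a b (Node z c d) 15%N); use (HL z a b c 15%N)
  |use (H (Node x a b) c d 12%N); use (H (Node z a b) c d 12%N);
   use (H a b (Node t c d) 15%N); use (HL t a b c 15%N); use (HL t a b c 3%N);
   use (HL t a b c 4%N)]; lra.
Qed.

(** By the two preceding lemmas, this means that inserting [theta] into the right and into the left
    input of [o] gives opposite values. *)
Lemma theta_shift o :
  theta g (Node o a b) c d = - theta g a b (Node o c d).
Proof.
move: (theta_left o) (theta_right o); rewrite /theta; case: o;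
  [use (H a (Node x b c) d 1%N); use (H a (Node z b c) d 1%N);
   use (HL x a b c 0%N); use (HL x a b c 1%N); use (HR x b c d 15%N);
   use (HR x b c d 3%N); use (HR x b c d 4%N)
  |use (H a (Node t b c) d 13%N); use (H a (Node y b c) d 13%N);
   use (HL y a b c 10%N); use (HL y a b c 11%N); use (HR y b c d 13%N);
   use (HR y b c d 14%N); use (HR y b c d 15%N)
  |use (H a (Node t b c) d 3%N); use (H a (Node y b c) d 3%N);
   use (HR z b c d 9%N); use (HR z b c d 13%N); use (HR z b c d 14%N);
   use (HR z b c d 15%N); use (HR z b c d 8%N)
  |use (H a (Node t b c) d 11%N); use (H a (Node y b c) d 11%N);
   use (HL t a b c 10%N); use (HL t a b c 11%N); use (HR t b c d 13%N);
   use (HR t b c d 14%N); use (HR t b c d 15%N)]; lra.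
Qed.

(** Under x(a, .), the relations of index 11 and 13 turn the sum into [theta g a b (Node y c d)], to
    which [theta_shift] applies. *)
Lemma theta_mid_xt :
  theta g a (Node x b c) d + theta g a (Node t b c) d = - theta g (Node y a b) c d.
Proof.
move: (theta_shift y); rewrite /theta.
use (HR x b c d 11%N); use (HR x b c d 13%N); lra.
Qed.

(** In the second form of [theta], the relations of index 1 and 3 merge the two terms. *)
Lemma theta_mid_yz :
  theta g a (Node y b c) d + theta g a (Node z b c) d = theta g (Node x a b) c d.
Proof.
rewrite /theta.
use (H a (Node y b c) d 15%N); use (H a (Node z b c) d 15%N);
use (H (Node x a b) c d 15%N); use (HL y a b c 1%N); use (HL y a b c 3%N); lra.
Qed.

Lemma theta_mid_y :
  theta g a (Node y b c) d = - theta g (Node y a b) c d.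
Proof.
move: (theta_left x) theta_mid_yz (theta_right x) (theta_shift t); rewrite /theta.
use (H a (Node t b c) d 0%N); use (H a (Node y b c) d 0%N);
use (H a (Node x b c) d 13%N); use (H a (Node x b c) d 14%N);
use (H a (Node x b c) d 15%N); use (H (Node t a b) c d 15%N);
use (H (Node y a b) c d 15%N); use (HL y a b c 9%N); use (HL y a b c 5%N);
use (HL y a b c 7%N); use (HL y a b c 8%N); use (HR x b c d 10%N);
use (HR x b c d 12%N); use (HR x b c d 15%N); use (HR x b c d 5%N);
use (HR x b c d 7%N); lra.
Qed.

Lemma theta_mid_x :
  theta g a (Node x b c) d = theta g (Node x a b) c d.
Proof.
move: theta_mid_xt (theta_shift x) (theta_shift z); rewrite /theta.
use (H a (Node y b c) d 0%N); use (H a (Node x b c) d 13%N);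
use (H a (Node z b c) d 13%N); use (H a (Node x b c) d 14%N);
use (H a (Node z b c) d 14%N); use (H a (Node t b c) d 15%N);
use (H a (Node y b c) d 15%N); use (H (Node y a b) c d 15%N);
use (H (Node z a b) c d 15%N); use (H a (Node y b c) d 1%N);
use (HL y a b c 0%N); use (HL y a b c 9%N); use (HL y a b c 1%N);
use (HL y a b c 2%N); use (HL y a b c 4%N); use (HL y a b c 5%N);
use (HL y a b c 6%N); use (HL y a b c 7%N); use (HR x b c d 9%N);
use (HR x b c d 5%N); use (HR x b c d 6%N); use (HR x b c d 7%N); lra.
Qed.

(** This sum and the next one express the values at t and z through those at x and y, which are then
    shown to vanish. *)
Lemma theta_sum_xyt :
  theta g (Node x a b) c d + theta g (Node y a b) c d + theta g (Node t a b) c d = 0.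
Proof.
move: theta_mid_y theta_mid_yz; rewrite /theta.
use (H a (Node z b c) d 13%N); use (H a (Node z b c) d 14%N);
use (H a (Node z b c) d 15%N); use (H (Node t a b) c d 15%N);
use (HL y a b c 6%N); use (HL y a b c 8%N); lra.
Qed.

Lemma theta_sum_xyz :
  theta g (Node x a b) c d + theta g (Node y a b) c d + theta g (Node z a b) c d = 0.
Proof.
move: theta_mid_x theta_mid_xt (theta_shift z); rewrite /theta.
use (H a (Node t b c) d 0%N); use (H a (Node t b c) d 1%N);
use (HR x b c d 6%N); use (HR x b c d 8%N); lra.
Qed.

Lemma theta_zero_x :
  theta g (Node x a b) c d = 0.
Proof.
move: theta_mid_y (theta_shift x) (theta_shift z) theta_sum_xyz; rewrite /theta.
use (H a (Node y b c) d 0%N); use (H a (Node y b c) d 1%N);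
use (HR x b c d 9%N); use (HR x b c d 5%N); use (HR x b c d 6%N);
use (HR x b c d 7%N); lra.
Qed.

Lemma theta_zero_y :
  theta g (Node y a b) c d = 0.
Proof.
move: theta_mid_xt theta_mid_yz (theta_shift t) theta_sum_xyt theta_zero_x.
rewrite /theta.
use (HR x b c d 10%N); use (HR x b c d 12%N); use (HR x b c d 13%N);
use (HR x b c d 14%N); lra.
Qed.
End Anomaly.

Lemma theta_compL g o d (gP : compat g) a b c :
  theta (fun s => g (Node o s d)) a b c = 0.
Proof.
have left0 := theta_zero_x gP; have left0' := theta_zero_y gP.
rewrite (theta_right gP) //.
have := theta_shift gP a b c d o; have := theta_sum_xyt gP a b c d.
have := theta_sum_xyz gP a b c d; rewrite left0 left0'.
by case: o; rewrite ?left0 ?left0'; lra.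
Qed.

Lemma theta_compR g o a (gP : compat g) b c d :
  theta (fun s => g (Node o a s)) b c d = 0.
Proof.
have left0 := theta_zero_x gP; have left0' := theta_zero_y gP.
rewrite (theta_left gP) //.
have := theta_sum_xyt gP a b c d; have := theta_sum_xyz gP a b c d.
by rewrite left0 left0'; case: o; rewrite ?left0 ?left0'; lra.
Qed.

(* On trees with more than three leaves [theta] is a combination of proper    *)
(* composites of the anomaly, hence zero.                                     *)
Lemma theta0 g (gP : compat g) (g3 : forall s, leaves s = 3 -> g s = 0) F a b c :
  theta (g \o plug F) a b c = 0.
Proof.
have in_root f (fP : compat f) : (forall s, leaves s = 3 -> f s = 0) ->
    theta f a b c = 0.
  move=> f3; have shift := theta_shift fP; have sum1 := theta_sum_xyt fP.
  have sum2 := theta_sum_xyz fP; have zx := theta_zero_x fP; have zy := theta_zero_y fP.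
  have zero o u v w d : theta f (Node o u v) w d = 0.
    have := sum1 u v w d; have := sum2 u v w d; rewrite zx zy.
    by case: o; rewrite ?zx ?zy; lra.
  (* A node in the third argument is shifted to the first, and one in the second is expressed
     through the first. With three leaves as arguments, both trees of [theta] have arity three and
     [f3] applies. *)
  case: a => [|o a1 a2]; last exact: zero.
  case: c => [|o c1 c2]; last by have := shift Leaf b c1 c2 o; rewrite zero; lra.
  case: b => [|o b1 b2]; first by rewrite /theta !f3 ?subrr.
  have := theta_mid_xt fP Leaf b1 b2 Leaf; have := theta_mid_yz fP Leaf b1 b2 Leaf.
  have := theta_mid_x fP Leaf b1 b2 Leaf; have := theta_mid_y fP Leaf b1 b2 Leaf.
  by rewrite !zero; case: o => *; lra.
(* Outer layers of the context are absorbed into [f]; the innermost one already kills [theta]. *)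
have in_ctx : forall G f, compat f -> G <> Hole -> theta (f \o plug G) a b c = 0.
  elim=> [//|o G IH r|o l G IH] f fP _.
    case: G IH => [_|o' G r' IH|o' l G IH].
    - exact: theta_compL.
    - by apply: (IH _ (compatL fP o r)).
    - by apply: (IH _ (compatL fP o r)).
  case: G IH => [_|o' G r' IH|o' l' G IH].
  - exact: theta_compR.
  - by apply: (IH _ (compatR fP o l)).
  - by apply: (IH _ (compatR fP o l)).
by case: F => [|o G r|o l G]; [exact: in_root|exact: in_ctx|exact: in_ctx].
Qed.

End RealField.

(** * Trees are determined by their shape and their marked leaf *)

Definition marks_left (o : op) : bool := if o is (x | t) then true else false.

Definition half (o : op) : op :=
  match o with x | z => x | y | t => t end.

Definition toggle (o : op) : op :=
  match o with x => z | z => x | y => t | t => y end.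

Fixpoint flat (s : tree) : tree :=
  if s is Node o l r then Node (half o) (flat l) (flat r) else Leaf.

Fixpoint pos (s : tree) : nat :=
  if s is Node o l r then
    if marks_left o then pos l else (leaves l + pos r)%N
  else 0%N.

Lemma leaves_flat s : leaves (flat s) = leaves s.
Proof. by elim: s => //= o l -> r ->. Qed.

Lemma pos_lt s : (pos s < leaves s)%N.
Proof. by elim: s => //= o l IHl r IHr; case: ifP => _; lia. Qed.

Lemma half_eq o o' : half o = half o' -> o' = o \/ o' = toggle o.
Proof.
by case: o; case: o' => //= _; [left|right|left|right|right|left|right|left].
Qed.

Section FlatPos.
Variable K : realFieldType.
Implicit Types (g : tree -> K) (a b c d l r : tree).

Definition thetaless g :=
  compat g /\ forall F a b c, theta (g \o plug F) a b c = 0.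

Lemma thetalessL g o r : thetaless g -> thetaless (fun s => g (Node o s r)).
Proof.
by case=> gP g0; split=> [|F]; [exact: compatL|exact: (g0 (CtxL o F r))].
Qed.

Lemma thetalessR g o l : thetaless g -> thetaless (fun s => g (Node o l s)).
Proof.
by case=> gP g0; split=> [|F]; [exact: compatR|exact: (g0 (CtxR o l F))].
Qed.

Definition toggles g := forall o a b, g (Node (toggle o) a b) = g (Node o a b).

(** The marked leaf is then in the left child, so the root of the right child should count only up
    to shape. Pairs of relations with a common left-hand side give this, together with [theta] = 0
    when o = x. *)
Lemma togglesR g o l :
  thetaless g -> marks_left o -> toggles (fun s => g (Node o l s)).
Proof.
case=> gP /(_ Hole l) g0 ox o' b c; move: (g0 b c) => {g0}; rewrite /theta /= => g0.
have H := compat_root gP l b c.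
by case: o ox => // _; case: o' => /=;
  use (H 0%N); use (H 1%N); use (H 5%N); use (H 6%N); use (H 10%N); use (H 11%N); lra.
Qed.

Lemma togglesL g o r :
  thetaless g -> ~~ marks_left o -> toggles (fun s => g (Node o s r)).
Proof.
case=> gP /(_ Hole) g0 oy o' b c; move: (g0 b c r) => {g0}; rewrite /theta /= => g0.
have H := compat_root gP b c r.
by case: o oy => // _; case: o' => /=;
  use (H 3%N); use (H 4%N); use (H 8%N); use (H 9%N); use (H 13%N); use (H 14%N);
  use (H 15%N); lra.
Qed.

Lemma toggles_half g o o' a b : toggles g -> half o = half o' ->
  g (Node o a b) = g (Node o' a b).
Proof. by move=> tg /half_eq[->//|->]; rewrite tg. Qed.

(** Since the root can be toggled, it is made to mark the right while the left child is changed, and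
    the left while the right child is changed; the child being changed can then itself be
    toggled. *)
Lemma flat_toggles s s' g : thetaless g -> toggles g -> flat s = flat s' -> g s = g s'.
Proof.
elim: s s' g => [|o l IHl r IHr] [|o' l' r'] //= g g0 tg [oo' ll' rr'].
pose ol := half o; pose or := toggle ol.
have half_ol : half o = half ol by rewrite /ol; case: (o).
have half_or : half ol = half or by rewrite /or /ol; case: (o).
rewrite (toggles_half _ _ tg (etrans half_ol half_or)).
have or_right : ~~ marks_left or by rewrite /or /ol; case: (o).
have ol_left : marks_left ol by rewrite /ol; case: (o).
rewrite (IHl l' (fun s => g (Node or s r))) //; [|exact: thetalessL|exact: togglesL].
rewrite -(toggles_half _ _ tg half_or).
rewrite (IHr r' (fun s => g (Node ol l' s))) //; [|exact: thetalessR|exact: togglesR].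
by apply: toggles_half; rewrite // -half_ol.
Qed.

(** At each node, the child containing the marked leaf is treated by induction and the other one by
    [flat_toggles]. *)
Lemma flat_pos_eq g s s' : thetaless g -> flat s = flat s' -> pos s = pos s' ->
  g s = g s'.
Proof.
elim: s s' g => [|o l IHl r IHr] [|o' l' r'] //= g g0 [oo' ll' rr'].
have lv : leaves l = leaves l' by rewrite -leaves_flat ll' leaves_flat.
have := pos_lt l; have := pos_lt l'.
(* Comparing [pos] with the number of leaves of the left child excludes roots that mark different
   sides. *)
case: ifP => ox; case: ifP => ox' ltl' ltl posE; try lia.
  have <- : o = o' by case: (o) (o') oo' ox ox' => [] [].
  rewrite (IHl l' (fun s => g (Node o s r))) //; last exact: thetalessL.
  by apply: (@flat_toggles _ _ (fun s => g (Node o l' s)));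
    [exact: thetalessR|exact: togglesR|].
have <- : o = o' by case: (o) (o') oo' ox ox' => [] [].
rewrite (IHr r' (fun s => g (Node o l s))) //; [|exact: thetalessR|lia].
by apply: (@flat_toggles _ _ (fun s => g (Node o s r')));
  [exact: thetalessL|apply: togglesL; rewrite ?ox|].
Qed.

(* [mark s j] relabels the path from the root to the leaf j so that it is     *)
(* followed by [pos].                                                         *)
Fixpoint mark (s : tree) (j : nat) : tree :=
  if s is Node o l r then
    if (j < leaves l)%N then Node (half o) (mark l j) r
    else Node (toggle (half o)) l (mark r (j - leaves l))
  else Leaf.

Lemma flat_mark s j : flat (mark s j) = flat s.
Proof.
by elim: s j => //= o l IHl r IHr j; case: ifP => _ /=; rewrite ?IHl ?IHr; case: o.
Qed.

Lemma leaves_mark s j : leaves (mark s j) = leaves s.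
Proof. by rewrite -leaves_flat flat_mark leaves_flat. Qed.

Lemma pos_mark s j : (j < leaves s)%N -> pos (mark s j) = j.
Proof.
elim: s j => [|o l IHl r IHr] j /=; first by case: j.
move=> jlr; case: ltnP => jl /=; first by case: (o); rewrite /= IHl.
by case: (o); rewrite /= IHr; lia.
Qed.

Lemma flat_flat s : flat (flat s) = flat s.
Proof. by elim: s => //= o l -> r ->; case: o. Qed.

Lemma mark_flat_pos g s : thetaless g -> g s = g (mark (flat s) (pos s)).
Proof.
move=> g0; apply: flat_pos_eq => //; first by rewrite flat_mark flat_flat.
by rewrite pos_mark // leaves_flat pos_lt.
Qed.

(** The dendriform axioms inside any context, with x as the product < and t as the product >. *)
Definition dendriform (V : zmodType) (f : tree -> V) := forall F a b c,
  [/\ f (plug F (Node x (Node x a b) c)) =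
        f (plug F (Node x a (Node x b c))) + f (plug F (Node x a (Node t b c))),
      f (plug F (Node x (Node t a b) c)) = f (plug F (Node t a (Node x b c))) &
      f (plug F (Node t (Node x a b) c)) + f (plug F (Node t (Node t a b) c)) =
        f (plug F (Node t a (Node t b c)))].

(** The leaf [j] lies either in the context or in [s]. The new context depends on [s] only through
    its number of leaves, so it serves all terms of a relation at once. *)
Lemma mark_plug F j n :
    (exists G, forall s, leaves s = n -> mark (plug F s) j = plug G s) \/
    (exists G i, forall s, leaves s = n -> mark (plug F s) j = plug G (mark s i)).
Proof.
elim: F j => [|o F IH r|o l F IH] j.
- by right; exists Hole, j.
- pose m := ((leaves (plug F Leaf)).-1 + n)%N.
  have mE s : leaves s = n -> leaves (plug F s) = m by rewrite leaves_plug => ->.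
  case: (ltnP j m) => jm.
    case: (IH j) => [[G GE]|[G [i GE]]]; [left|right].
      by exists (CtxL (half o) G r) => s sn /=; rewrite mE // jm GE.
    by exists (CtxL (half o) G r), i => s sn /=; rewrite mE // jm GE.
  left; exists (CtxL (toggle (half o)) F (mark r (j - m))) => s sn /=.
  by rewrite mE // ltnNge jm.
- case: (ltnP j (leaves l)) => jl.
    left; exists (CtxR (half o) (mark l j) F) => s sn /=.
    by rewrite jl.
  case: (IH (j - leaves l)%N) => [[G GE]|[G [i GE]]]; [left|right].
    by exists (CtxR (toggle (half o)) l G) => s sn /=; rewrite ltnNge jl /= GE.
  by exists (CtxR (toggle (half o)) l G), i => s sn /=; rewrite ltnNge jl /= GE.
Qed.

(** Each dendriform axiom lifts to one of three relations, according to the argument holding the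
    marked leaf; a leaf outside gives the same relations as one in [a]. *)
Lemma dendriform_mark g j : compat g -> dendriform (fun s => g (mark s j)).
Proof.
move=> gP F a b c.
have [[G GE]|[G [i GE]]] := mark_plug F j (leaves a + (leaves b + leaves c)).
  have H := gP G a b c; rewrite !GE /= ?addnA //.
  by split; [use (H 0%N)|use (H 5%N)|use (H 10%N)]; lra.
rewrite !GE /= ?addnA //.
case: (ltnP i (leaves a)) => ia /=.
  have -> : (i < leaves a + leaves b)%N by lia.
  have H := gP G (mark a i) b c; rewrite ?ia /= ?ia.
  by split; [use (H 0%N)|use (H 5%N)|use (H 10%N)]; lra.
case: (ltnP (i - leaves a) (leaves b)) => ib /=.
  have -> : (i < leaves a + leaves b)%N by lia.
  have H := gP G a (mark b (i - leaves a)) c; rewrite /=.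
  by split; [use (H 2%N)|use (H 7%N)|use (H 12%N)]; lra.
have -> : (i < leaves a + leaves b)%N = false by lia.
have H := gP G a b (mark c (i - leaves a - leaves b)); rewrite subnDA /=.
by split; [use (H 3%N)|use (H 8%N)|use (H 13%N)]; lra.
Qed.
End FlatPos.

(** * Dendriform normal forms *)

Inductive btree := BL | BN of btree & btree.

Fixpoint btree_code (b : btree) : tree :=
  if b is BN l r then Node x (btree_code l) (btree_code r) else Leaf.

Fixpoint btree_decode (s : tree) : btree :=
  if s is Node _ l r then BN (btree_decode l) (btree_decode r) else BL.

Fact btree_codeK : cancel btree_code btree_decode.
Proof. by elim=> //= l -> r ->. Qed.

HB.instance Definition _ := Countable.copy btree (can_type btree_codeK).

Fixpoint nodes (b : btree) : nat :=
  if b is BN l r then (nodes l + nodes r).+1 else 0%N.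

(* Loday's basis of the free dendriform algebra on one generator e: the tree  *)
(* BN l r is (l > e) < r, where an empty factor is dropped.                   *)
Fixpoint std (b : btree) : tree :=
  match b with
  | BL => Leaf
  | BN BL BL => Leaf
  | BN l BL => Node t (std l) Leaf
  | BN BL r => Node x Leaf (std r)
  | BN l r => Node x (Node t (std l) Leaf) (std r)
  end.

Lemma std_BNr l r : (0 < nodes r)%N -> std (BN l r) = Node x (std (BN l BL)) (std r).
Proof. by case: r => //; case: l. Qed.

Lemma std_BNl l : (0 < nodes l)%N -> std (BN l BL) = Node t (std l) Leaf.
Proof. by case: l. Qed.

(** The maximum is due to [std BL], a placeholder with one leaf. *)
Lemma leaves_std b : leaves (std b) = maxn 1 (nodes b).
Proof.
by elim: b => [|[|l1 r1] IHl [|l2 r2] IHr] //=; rewrite /= in IHl IHr *; lia.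
Qed.

Lemma flat_std b : flat (std b) = std b.
Proof.
elim: b => [|[|l1 r1] IHl [|l2 r2] IHr] //=; rewrite /= in IHl IHr *; congruence.
Qed.

Section NormalForm.
Variable V : zmodType.
Implicit Types (f : tree -> V) (b c d : btree).

Lemma dendriformL f o r : dendriform f -> dendriform (fun s => f (Node o s r)).
Proof. by move=> fP F; apply: (fP (CtxL o F r)). Qed.

Lemma dendriformR f o l : dendriform f -> dendriform (fun s => f (Node o l s)).
Proof. by move=> fP F; apply: (fP (CtxR o l F)). Qed.

(** Dual form of the fact that a product of two basis elements is a combination of basis elements.
    The induction is on the total number of nodes. *)
Lemma dendriform_std2 b c f : (0 < nodes b)%N -> (0 < nodes c)%N -> dendriform f ->
    (forall d, nodes d = (nodes b + nodes c)%N -> f (std d) = 0) ->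
  f (Node x (std b) (std c)) = 0 /\ f (Node t (std b) (std c)) = 0.
Proof.
have [n] := ubnP (nodes b + nodes c); elim: n => // n IH in b c f *.
move=> bcn b0 c0 fP f0.
have IHx b' c' (h : tree -> V) : (nodes b' + nodes c' < n)%N -> (0 < nodes b')%N ->
    (0 < nodes c')%N -> dendriform h ->
    (forall d, nodes d = (nodes b' + nodes c')%N -> h (std d) = 0) ->
    h (Node x (std b') (std c')) = 0.
  by move=> *; apply: (IH b' c' h _ _ _ _ _).1.
have IHt b' c' (h : tree -> V) : (nodes b' + nodes c' < n)%N -> (0 < nodes b')%N ->
    (0 < nodes c')%N -> dendriform h ->
    (forall d, nodes d = (nodes b' + nodes c')%N -> h (std d) = 0) ->
    h (Node t (std b') (std c')) = 0.
  by move=> *; apply: (IH b' c' h _ _ _ _ _).2.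
split.
- case: b b0 bcn f0 => // l r _ bcn f0; have [r0|r0] := posnP (nodes r).
    by case: r r0 bcn f0 => // _ _ f0; rewrite -std_BNr // f0 //= addn0.
  (* With A = [std (BN l BL)], (A < r) < c = A < (r < c + r > c), where the inner products are
     smaller. *)
  rewrite std_BNr //; case: (fP Hole (std (BN l BL)) (std r) (std c)) => /= -> _ _.
  pose h s := f (Node x (std (BN l BL)) s).
  have hP : dendriform h by exact: dendriformR.
  have h0 d : nodes d = (nodes r + nodes c)%N -> h (std d) = 0.
    move=> dE; rewrite /h -std_BNr; first by rewrite f0 //= dE; lia.
    by rewrite dE; lia.
  have lt_n : (nodes r + nodes c < n)%N by rewrite /= in bcn; lia.
  by rewrite -[X in X + _]/(h _) -[X in _ + X]/(h _) IHx ?IHt ?addr0.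
case: c c0 bcn f0 => // l r _ bcn f0; have [l0|l0] := posnP (nodes l).
  case: l l0 bcn f0 => // _ bcn f0; have [r0|r0] := posnP (nodes r).
    by case: r r0 bcn f0 => // _ _ f0; rewrite -std_BNl // f0 //=; lia.
  rewrite std_BNr //; case: (fP Hole (std b) Leaf (std r)) => /= _ <- _.
  by rewrite -std_BNl // -std_BNr // f0 //=; lia.
have lt_n : (nodes b + nodes l < n)%N by rewrite /= in bcn; lia.
(* Here b > ((l > e) < r) = (b > (l > e)) < r, and [F] is the context . < r, or the hole if r is
   empty. Then b > (l > e) = (b < l + b > l) > e, with smaller inner products. *)
have [F FE F0] : exists2 F, f (Node t (std b) (std (BN l r))) =
      f (plug F (Node t (std b) (Node t (std l) Leaf))) &
    forall d, nodes d = (nodes b + nodes l)%N -> f (plug F (Node t (std d) Leaf)) = 0.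
  have [r0|r0] := posnP (nodes r).
    exists Hole => [|d dE]; first by case: r r0 {bcn f0} => // _; rewrite std_BNl.
    case: r r0 bcn f0 => // _ bcn f0.
    by rewrite /= -std_BNl ?f0 //= dE; lia.
  exists (CtxL x Hole (std r)) => [|d dE].
    rewrite std_BNr // std_BNl //.
    by case: (fP Hole (std b) (Node t (std l) Leaf) (std r)) => /= _ <- _.
  by rewrite /= -std_BNl -?std_BNr ?f0 //= dE; lia.
rewrite FE; case: (fP F (std b) (std l) Leaf) => _ _ <-.
pose h s := f (plug F (Node t s Leaf)).
have hP : dendriform h.
  apply: (@dendriformL (fun s => f (plug F s))); rewrite {}/h.
  elim: F f fP {IHx IHt f0 FE F0} => [|o F IHF u|o u F IHF] h hP //=.
  - exact: (IHF _ (dendriformL o u hP)).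
  - exact: (IHF _ (dendriformR o u hP)).
by rewrite -[X in X + _]/(h _) -[X in _ + X]/(h _) IHx ?IHt ?addr0.
Qed.

(** The children are replaced by basis trees one after the other; [dendriform_std2] then handles the
    root. *)
Lemma dendriform_std f s : flat s = s -> dendriform f ->
  (forall b, nodes b = leaves s -> f (std b) = 0) -> f s = 0.
Proof.
elim: s f => [|o l IHl r IHr] f /=; first by move=> _ _ f0; apply: (f0 (BN BL BL)).
case=> oE lE rE fP f0; have := leaves_gt0 l; have := leaves_gt0 r => r0 l0.
apply: (IHl (fun s => f (Node o s r))) => // [|b bl]; first exact: dendriformL.
apply: (IHr (fun s => f (Node o (std b) s))) => // [|c cr]; first exact: dendriformR.
have := @dendriform_std2 b c f; rewrite bl cr => /(_ l0 r0 fP f0) [fx ft].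
by rewrite -oE; case: (o).
Qed.
End NormalForm.

(** The spanning statement in dual form. Vanishing in arity three is what makes [theta] vanish on
    leaves as well. *)
Lemma compat_vanish (K : realFieldType) (g : tree -> K) n :
    compat g -> (forall s, leaves s = 3 -> g s = 0) ->
    (forall b j, nodes b = n -> (j < n)%N -> g (mark (std b) j) = 0) ->
  forall s, leaves s = n -> g s = 0.
Proof.
move=> gP g3 g0 s sn; have gT : thetaless g by split=> // F a b c; exact: theta0.
rewrite mark_flat_pos //.
apply: (dendriform_std (flat_flat s) (dendriform_mark _ gP)) => b.
by rewrite leaves_flat sn => bn; apply: g0; rewrite // -sn pos_lt.
Qed.

(** * The free dendriform algebra on one generator *)

Section FreeDendriform.
Variable V : zmodType.
Implicit Types (a b c d l r : btree) (u v w s : tree).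

(* [star a b phi] is the sum of phi over the product a * b in the free        *)
(* dendriform algebra with unit BL, and [eval u phi] the sum of phi over the  *)
(* value of u at the generator, an element BN l r of the basis being passed   *)
(* to phi as the pair of l and r. Being linear in phi, these need no formal   *)
(* linear combinations of binary trees.                                       *)
Fixpoint star a : btree -> (btree -> V) -> V :=
  match a with
  | BL => fun b phi => phi b
  | BN la ra => fix star_a b phi :=
      match b with
      | BL => phi a
      | BN lb rb =>
          star ra b (fun d => phi (BN la d)) + star_a lb (fun d => phi (BN d rb))
      end
  end.

(** Loday's recursion: BN l1 r1 < b is BN l1 (r1 * b), and a > BN l2 r2 is BN (a * l2) r2. *)
Definition op_eval (o : op) l1 r1 l2 r2 (phi : btree -> btree -> V) : V :=
  if half o is x then star r1 (BN l2 r2) (phi l1)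
  else star (BN l1 r1) l2 (fun d => phi d r2).

Fixpoint eval u (phi : btree -> btree -> V) : V :=
  if u is Node o v w then
    eval v (fun l1 r1 => eval w (fun l2 r2 => op_eval o l1 r1 l2 r2 phi))
  else phi BL BL.

Lemma starD a b (phi psi : btree -> V) :
  star a b (fun d => phi d + psi d) = star a b phi + star a b psi.
Proof.
elim: a b phi psi => [//|la _ ra IHr] /=; elim=> [//|lb IHb rb _] phi psi.
by rewrite IHr IHb addrACA.
Qed.

Lemma star_exchange a b c d (phi : btree -> btree -> V) :
  star a b (fun e => star c d (phi e)) = star c d (fun f => star a b (phi^~ f)).
Proof.
elim: a b phi => [//|la _ ra IHr] /=; elim=> [//|lb IHb rb _] phi.
by rewrite starD IHr IHb.
Qed.

Lemma evalD u (phi psi : btree -> btree -> V) :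
  eval u (fun l r => phi l r + psi l r) = eval u phi + eval u psi.
Proof.
elim: u phi psi => [//|o v IHv w IHw] phi psi /=.
rewrite -IHv; congr eval; apply/funext=> l1; apply/funext=> r1.
rewrite -IHw; congr eval; apply/funext=> l2; apply/funext=> r2.
by rewrite /op_eval; case: (half o); rewrite -starD.
Qed.

Lemma star_eval a b u (phi : btree -> btree -> btree -> V) :
  star a b (fun e => eval u (phi e)) =
  eval u (fun l r => star a b (fun e => phi e l r)).
Proof.
elim: a b phi => [//|la _ ra IHr] /=; elim=> [//|lb IHb rb _] phi.
by rewrite evalD IHr IHb.
Qed.

Lemma eval_exchange u v (phi : btree -> btree -> btree -> btree -> V) :
  eval u (fun l r => eval v (phi l r)) =
  eval v (fun l' r' => eval u (fun l r => phi l r l' r')).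
Proof.
elim: u phi => [//|o u1 IH1 u2 IH2] phi /=.
rewrite -IH1; congr eval; apply/funext=> l1; apply/funext=> r1.
rewrite -IH2; congr eval; apply/funext=> l2; apply/funext=> r2.
by rewrite /op_eval; case: (half o); rewrite star_eval.
Qed.

Lemma starBr a (phi : btree -> V) : star a BL phi = phi a.
Proof. by case: a. Qed.

Lemma starNN la ra lb rb (phi : btree -> V) :
  star (BN la ra) (BN lb rb) phi =
  star ra (BN lb rb) (fun d => phi (BN la d)) +
  star (BN la ra) lb (fun d => phi (BN d rb)).
Proof. by []. Qed.

Lemma starA a b c (phi : btree -> V) :
  star a b (fun d => star d c phi) = star b c (fun d => star a d phi).
Proof.
elim: a b c phi => [//|la _ ra IHa] b; elim=> [|lc IHc rc _] phi.
  by rewrite starBr; congr star; apply/funext=> d; rewrite starBr.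
case: b IHc => [//|lb rb] IHc; rewrite [LHS]starNN [RHS]starNN.
under eq_fun do rewrite starNN.
under [X in _ + star _ _ X]eq_fun do rewrite starNN.
under [X in _ = star _ _ X + _]eq_fun do rewrite starNN.
under [X in _ = _ + star _ _ X]eq_fun do rewrite starNN.
(* Both sides consist of a < (b * c), (a > b) < c and (a * b) > c, matched respectively by induction
   on [a], by exchange of sums and by induction on [c]. *)
rewrite !starD IHa star_exchange -!addrA; congr (_ + _).
rewrite -IHc starNN [RHS]addrCA.
by congr (_ + _); rewrite addrCA.
Qed.

Local Arguments star : simpl never.

Lemma eval_dendriform u v w (phi : btree -> btree -> V) :
  [/\ eval (Node x (Node x u v) w) phi =
        eval (Node x u (Node x v w)) phi + eval (Node x u (Node t v w)) phi,
      eval (Node x (Node t u v) w) phi = eval (Node t u (Node x v w)) phi &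
      eval (Node t (Node x u v) w) phi + eval (Node t (Node t u v) w) phi =
        eval (Node t u (Node t v w)) phi].
Proof.
split; rewrite /= -?evalD; congr eval; apply/funext=> l1; apply/funext=> r1;
  rewrite -?evalD; congr eval; apply/funext=> l2; apply/funext=> r2.
- rewrite /op_eval /= star_eval -evalD.
  by congr eval; apply/funext=> l3; apply/funext=> r3; rewrite starA starNN.
- rewrite /op_eval /= star_eval.
  by congr eval; apply/funext=> l3; apply/funext=> r3; rewrite star_exchange.
- rewrite /op_eval /= !star_eval -evalD.
  by congr eval; apply/funext=> l3; apply/funext=> r3; rewrite -starA starNN.
Qed.

Lemma eval_plug F phi : exists psi, forall s, eval (plug F s) phi = eval s psi.
Proof.
elim: F phi => [|o F IH r|o l F IH] phi; first by exists phi.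
  exact: IH.
have [psi psiE] := IH (fun l2 r2 => eval l (fun l1 r1 => op_eval o l1 r1 l2 r2 phi)).
by exists psi => s; rewrite -psiE /= eval_exchange.
Qed.

Lemma pos_plug F n :
  exists p : nat -> nat, forall s, leaves s = n -> pos (plug F s) = p (pos s).
Proof.
elim: F => [|o F [p IH] r|o l F [p IH]]; first by exists id.
  pose m := ((leaves (plug F Leaf)).-1 + n)%N.
  exists (fun i => if marks_left o then p i else (m + pos r)%N) => s sn /=.
  by rewrite IH // leaves_plug sn.
exists (fun i => if marks_left o then pos l else (leaves l + p i)%N) => s sn /=.
by rewrite IH.
Qed.

Lemma evalN o u v phi : eval (Node o u v) phi =
  eval u (fun l1 r1 => eval v (fun l2 r2 => op_eval o l1 r1 l2 r2 phi)).
Proof. by []. Qed.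

Local Arguments eval : simpl never.

(** In each of the first fifteen relations all trees mark the same leaf, and their shapes form a
    dendriform axiom. In the last one the terms cancel in pairs of equal shape and mark. *)
Lemma eval_compat j phi : compat (fun s => if pos s == j then eval s phi else 0).
Proof.
move=> F a b c k; rewrite /relvals /=.
have [p pE] := pos_plug F (leaves a + (leaves b + leaves c)).
have [psi psiE] := eval_plug F phi.
rewrite !psiE !pE ?[leaves (Node _ _ _)]/= ?addnA // {pE psiE}.
have [xx xt tt] := eval_dendriform a b c psi.
rewrite /= ?addnA; do 15! [case: k => [|k] /=; first by case: ifP => _;
  rewrite ?addr0 ?subrr //; apply/eqP; rewrite subr_eq0; apply/eqP;
  (exact: xx || exact: etrans xx (addrC _ _) || exact: xt || exact: tt)].
case: k => [|k] /=; last by rewrite nth_nil.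
by rewrite -[RHS]addr0; congr (_ + _); case: ifP => _; exact: subrr.
Qed.

Lemma eval_std b phi : (0 < nodes b)%N ->
  eval (std b) phi = if b is BN l r then phi l r else 0.
Proof.
elim: b phi => //= l IHl r IHr phi _.
have stdl chi : eval (std (BN l BL)) chi = chi l BL.
  have [l0|l0] := posnP (nodes l); first by case: (l) l0.
  rewrite std_BNl // evalN IHl //.
  by case: (l) l0.
have [r0|r0] := posnP (nodes r); first by case: r r0 {IHr} => // _; exact: stdl.
rewrite -[X in eval X]/(std (BN l r)) std_BNr // evalN stdl IHr //.
by case: (r) r0.
Qed.

Lemma eval_flat s phi : eval (flat s) phi = eval s phi.
Proof.
elim: s phi => //= o l IHl r IHr phi.
rewrite !evalN IHl; congr eval.
apply/funext=> l1; apply/funext=> r1; rewrite IHr; congr eval.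
by apply/funext=> l2; apply/funext=> r2; rewrite /op_eval; case: o.
Qed.

End FreeDendriform.

Definition coeff (K : fieldType) (b : btree) (j : nat) (s : tree) : K :=
  if pos s == j then eval s (fun l r => (BN l r == b)%:R) else 0.

Lemma coeff_mark_std (K : fieldType) b j b' j' :
    nodes b = nodes b' -> (j < nodes b)%N ->
  coeff K b' j' (mark (std b) j) = ((b == b') && (j == j'))%:R.
Proof.
move=> bb' jb; rewrite /coeff pos_mark; last by rewrite leaves_std; lia.
rewrite -eval_flat flat_mark flat_std eval_std; last by lia.
by case: b {bb'} jb => // l r _; case: (j == j'); rewrite ?andbT ?andbF.
Qed.

(** * Functionals vanishing on the ideal *)

(** Simultaneous substitution at all leaves. Combined with contexts, it absorbs partial composition
    on either side. *)
Fixpoint subst (u : tree) (sigma : nat -> tree) : tree :=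
  if u is Node o l r then
    Node o (subst l sigma) (subst r (fun k => sigma (leaves l + k)%N))
  else sigma 0%N.

Lemma subst_Leaf u : subst u (fun=> Leaf) = u.
Proof. by elim: u => //= o l -> r ->. Qed.

(** The grafted tree is absorbed into the substitution; later leaves are shifted by [leaves u] -
    1. *)
Lemma subst_graftL s i u sigma tau : (i < leaves s)%N ->
    (forall k, (k < i)%N -> tau k = sigma k) ->
    tau i = subst u (fun k => sigma (i + k)%N) ->
    (forall k, (i < k)%N -> tau k = sigma (k + leaves u).-1) ->
  subst (graft s i u) sigma = subst s tau.
Proof.
elim: s i sigma tau => [|o l IHl r IHr] i sigma tau /=.
  by case: i => // _ _ ->.
have u0 := leaves_gt0 u => ilt lo mid hi; case: ltnP => il /=.
  congr Node; first by apply: IHl.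
  congr subst; apply/funext=> k; rewrite hi ?leaves_graft //; last by lia.
  by congr sigma; lia.
congr Node.
  have: forall k, (k < leaves l)%N -> sigma k = tau k.
    by move=> k kl; rewrite lo //; lia.
  elim: (l) (sigma) (tau) => [|o' l1 IH1 l2 IH2] f g /= fg; first exact: fg.
  congr Node; first by apply: IH1 => k kl; apply: fg; lia.
  by apply: IH2 => k kl; apply: fg; lia.
apply: IHr; first by lia.
- by move=> k kl; rewrite lo //; lia.
- by rewrite subnKC // mid; congr subst; apply/funext=> k; rewrite addnA subnKC.
- by move=> k kl; rewrite hi ?leaves_graft //; [congr sigma|]; lia.
Qed.

(** The outer tree is absorbed into a context that is the same for all [u] of arity [n]. *)
Lemma subst_graftR s i n sigma : (i < leaves s)%N ->
  exists F, forall u, leaves u = n ->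
    subst (graft s i u) sigma = plug F (subst u (fun k => sigma (i + k)%N)).
Proof.
elim: s i sigma => [|o l IHl r IHr] i sigma /=.
  by case: i => // _; exists Hole => u _.
move=> ilt; case: ltnP => il.
  have [F FE] := IHl i sigma il.
  exists (CtxL o F (subst r (fun k => sigma ((leaves l + n).-1 + k)%N))) => u un /=.
  by rewrite FE // leaves_graft // un.
have ir : (i - leaves l < leaves r)%N by lia.
have [F FE] := IHr (i - leaves l)%N (fun k => sigma (leaves l + k)%N) ir.
exists (CtxR o (subst l sigma) F) => u un /=; rewrite FE //.
by congr (Node _ _ (plug _ (subst _ _))); apply/funext=> k; rewrite addnA subnKC.
Qed.

Fixpoint comp_ctx (F G : ctx) : ctx :=
  match F with
  | Hole => G
  | CtxL o F r => CtxL o (comp_ctx F G) r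
  | CtxR o l F => CtxR o l (comp_ctx F G)
  end.

Lemma plug_comp F G s : plug (comp_ctx F G) s = plug F (plug G s).
Proof. by elim: F => //= [o F -> r|o l F ->]. Qed.

Lemma map_relvals (U V : zmodType) (f : {additive U -> V}) L R :
  map f (relvals L R) = relvals (fun o1 o2 => f (L o1 o2)) (fun o1 o2 => f (R o1 o2)).
Proof. by rewrite /relvals /= !(raddfB, raddfD). Qed.

Lemma nth_map_raddf (U V : zmodType) (f : {additive U -> V}) (w : seq U) k :
  (map f w)`_k = f w`_k.
Proof.
have [lt|ge] := ltnP k (size w); first by rewrite (nth_map 0).
by rewrite !nth_default ?size_map // raddf0.
Qed.

Lemma compat_comp (U V : zmodType) (f : {additive U -> V}) g :
  compat g -> compat (fun s => f (g s)).
Proof.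
move=> gP F a b c k; have /(congr1 f) := gP F a b c k.
by rewrite raddf0 -nth_map_raddf map_relvals.
Qed.

Lemma relators_relvals (K : fieldType) :
  relators (-1) = relvals (@lmon K) (@rmon K).
Proof. by rewrite /relators scaleN1r opprK. Qed.

Section Linear.
Variables (K : fieldType) (V : lmodType K).
Implicit Types (h : tree -> V).

Definition lin n h (f : free_op K n) : V := \sum_(u : ntree n) (f u : K) *: h (val u).

Lemma lin_is_linear n h : linear (@lin n h).
Proof.
move=> a f g; rewrite /lin scaler_sumr -big_split; apply: eq_bigr => u _.
by rewrite !ffunE scalerDl scalerA.
Qed.

HB.instance Definition _ n h := GRing.isLinear.Build K (free_op K n) V _ (@lin n h)
  (lin_is_linear h).

Lemma lin_monomial n h s : lin h (monomial K n s) = if leaves s == n then h s else 0.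
Proof.
rewrite /lin; case: eqP => sn; last first.
  rewrite big1 // => u _; rewrite ffunE; case: eqP => [us|]; last by rewrite scale0r.
  by case: sn; rewrite -us (eqP (valP u)).
pose u0 : ntree n := exist _ s (introT eqP sn).
rewrite (bigD1 u0) //= ffunE eqxx scale1r big1 ?addr0 // => u uu0.
by rewrite ffunE -[s]/(val u0) (inj_eq val_inj) (negPf uu0) scale0r.
Qed.

Lemma lin_partial_comp m n (f : free_op K m) (i : 'I_m) (g : free_op K n) h :
  lin h (partial_comp f i g) =
  \sum_(u : ntree m) \sum_(v : ntree n)
    ((f u : K) * (g v : K)) *: h (graft (val u) i (val v)).
Proof.
have -> : partial_comp f i g = \sum_(u : ntree m) \sum_(v : ntree n)
    (((f u : K) * (g v : K)) *: monomial K (m + n).-1 (graft (val u) i (val v)) :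
      free_op K _).
  apply/ffunP=> w; rewrite ffunE sum_ffunE; apply: eq_bigr => u _.
  rewrite sum_ffunE big_mkcond; apply: eq_bigr => v _.
  by rewrite !ffunE eq_sym; case: eqP => _; rewrite ?scaler0 // /GRing.scale /= mulr1.
rewrite linear_sum; apply: eq_bigr => u _; rewrite linear_sum; apply: eq_bigr => v _.
rewrite linearZ /= lin_monomial leaves_graft ?(eqP (valP u)) ?(eqP (valP v)) ?eqxx //.
Qed.

Lemma compat_generated_ideal h n (f : free_op K n) :
  compat h -> generated_ideal (relators (-1)) f -> lin h f = 0.
Proof.
move=> hP If.
(* The largest operadic ideal on which h vanishes. *)
pose I m (f : free_op K m) :=
  forall F sigma, lin (fun u => h (plug F (subst u sigma))) f = 0.
suff : I n f.
  move=> /(_ Hole (fun=> Leaf)) <-; rewrite /lin; apply: eq_bigr => u _.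
  by rewrite /= subst_Leaf.
apply: If => [|r rR F sigma]; last first.
  have : r \in relvals (@lmon K) (@rmon K) by rewrite -relators_relvals.
  move=> /(nthP 0)[k _ <-] {r rR}; set phi := (X in lin X).
  rewrite -(nth_map_raddf (lin phi)) map_relvals.
  (* A relator has arity three, so only these three values of [sigma] occur. *)
  rewrite -[RHS](hP F (sigma 0%N) (sigma 1%N) (sigma 2%N) k).
  by congr ((relvals _ _)`_k); apply/funext=> o1; apply/funext=> o2;
    rewrite /= lin_monomial.
split=> [m F sigma|m a f1 f2 If1 If2 F sigma|m p f1 i f2 If1 F sigma|
         m p f1 i f2 If2 F sigma].
- exact: linear0.
- by rewrite linearP /= If1 If2 scaler0 addr0.
- rewrite lin_partial_comp exchange_big /= big1 // => v _.
  pose tau k := if (k < i)%N then sigma k else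
    if k == i :> nat then subst (val v) (fun k => sigma (i + k)%N)
    else sigma (k + leaves (val v)).-1.
  transitivity ((f2 v : K) *: lin (fun u => h (plug F (subst u tau))) f1); last first.
    by rewrite If1 scaler0.
  rewrite /lin scaler_sumr; apply: eq_bigr => u _.
  rewrite scalerA mulrC (@subst_graftL _ _ _ _ tau) ?(eqP (valP u)) //.
  + by move=> k ki; rewrite /tau ki.
  + by rewrite /tau ltnn eqxx.
  + by move=> k ki; rewrite /tau ltnNge ltnW // gtn_eqF.
- rewrite lin_partial_comp big1 // => u _.
  have iu : (i < leaves (val u))%N by rewrite (eqP (valP u)).
  have [G GE] := subst_graftR p sigma iu.
  transitivity ((f1 u : K) *:
      lin (fun v => h (plug (comp_ctx F G) (subst v (fun k => sigma (i + k)%N)))) f2).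
    rewrite /lin scaler_sumr; apply: eq_bigr => v _.
    by rewrite scalerA plug_comp GE // (eqP (valP v)).
  by rewrite If2 scaler0.
Qed.
End Linear.

(** * Closure of the ideal under contexts, and the quotient map as a compatible function *)

Section IdealClosure.
Variables (K : fieldType) (R : seq (free_op K 3)).

Let idR := generated_ideal_is_ideal R.

Lemma lin_ext (V : lmodType K) m (g h : tree -> V) (f : free_op K m) :
  (forall u, leaves u = m -> g u = h u) -> lin g f = lin h f.
Proof.
by move=> gh; rewrite /lin; apply: eq_bigr => u _; rewrite gh ?(eqP (valP u)).
Qed.

Lemma partial_comp_monomialr m k (f : free_op K m) (i : 'I_m) s : leaves s = k ->
  partial_comp f i (monomial K k s) =
  lin (fun u => monomial K (m + k).-1 (graft u i s)) f.
Proof.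
move=> sk; pose u0 : ntree k := exist _ s (introT eqP sk).
apply/ffunP=> w; rewrite ffunE sum_ffunE; apply: eq_bigr => u _.
rewrite big_mkcond (bigD1 u0) //= big1 ?addr0 => [|v vu0].
  by rewrite !ffunE eqxx mulr1 eq_sym /GRing.scale /=; case: eqP; rewrite ?mulr1 ?mulr0.
by rewrite ffunE -[s]/(val u0) (inj_eq val_inj) (negPf vu0) mulr0 if_same.
Qed.

Lemma partial_comp_monomiall m k (f : free_op K m) (i : 'I_k) s : leaves s = k ->
  partial_comp (monomial K k s) i f =
  lin (fun u => monomial K (k + m).-1 (graft s i u)) f.
Proof.
move=> sk; pose u0 : ntree k := exist _ s (introT eqP sk).
apply/ffunP=> w; rewrite ffunE sum_ffunE (bigD1 u0) //= [X in _ + X]big1 => [|v vu0].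
  rewrite addr0 big_mkcond; apply: eq_bigr => u _.
  by rewrite !ffunE eqxx mul1r eq_sym /GRing.scale /=; case: eqP; rewrite ?mulr1 ?mulr0.
by apply: big1 => u _; rewrite ffunE -[s]/(val u0) (inj_eq val_inj) (negPf vu0) mul0r.
Qed.

(** Reduces contexts and substitution of arguments to partial compositions with a monomial. *)
Definition stable m n (phi : tree -> tree) :=
  (forall u, leaves u = m -> leaves (phi u) = n) /\
  (forall f : free_op K m,
     generated_ideal R f -> generated_ideal R (lin (fun u => monomial K n (phi u)) f)).

Lemma stable_graft m i s :
  (i < m)%N -> stable m (m + leaves s).-1 (fun u => graft u i s).
Proof.
move=> im; split=> [u um|f If]; first by rewrite leaves_graft um.
rewrite -(partial_comp_monomialr f (Ordinal im) (erefl (leaves s))).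
exact: (ideal_compl idR).
Qed.

Lemma stable_NodeL m o r : stable m (m + leaves r) (fun u => Node o u r).
Proof.
split=> [u /= -> //|f If].
have := ideal_compr idR (monomial K (1 + leaves r) (Node o Leaf r)) ord0 If.
by rewrite partial_comp_monomiall //= addnC.
Qed.

Lemma stable_NodeR m o l : stable m (leaves l + m) (fun u => Node o l u).
Proof.
split=> [u /= -> //|f If].
have lt : (leaves l < leaves l + 1)%N by lia.
have := ideal_compr idR (monomial K (leaves l + 1) (Node o l Leaf)) (Ordinal lt) If.
rewrite partial_comp_monomiall //= ltnn.
by rewrite (_ : (leaves l + 1 + m).-1 = (leaves l + m)%N) //; lia.
Qed.

Lemma stable_comp m n p (phi psi : tree -> tree) :
  stable m n phi -> stable n p psi -> stable m p (fun u => psi (phi u)).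
Proof.
move=> [phin sphi] [psip spsi]; split=> [u um|f If]; first by rewrite psip ?phin.
have -> // : lin (fun u => monomial K p (psi (phi u))) f =
  lin (fun u => monomial K p (psi u)) (lin (fun u => monomial K n (phi u)) f).
  rewrite [in RHS](_ : lin (fun u => monomial K n (phi u)) f =
    \sum_(u : ntree m) (f u : K) *: monomial K n (phi (val u))) // linear_sum.
  apply: eq_bigr => u _.
  by rewrite linearZ /= lin_monomial phin ?eqxx // (eqP (valP u)).
exact: (spsi _ (sphi _ If)).
Qed.

Lemma stable_plug m F : exists n, stable m n (plug F).
Proof.
elim: F => [|o F [n sF] r|o l F [n sF]].
- exists m; split=> // f If.
  suff -> : lin (fun u => monomial K m (plug Hole u)) f = f by [].
  apply/ffunP=> w; rewrite sum_ffunE (bigD1 w) //= big1 ?addr0 => [|v vw].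
    by rewrite !ffunE eqxx /GRing.scale /= mulr1.
  by rewrite !ffunE (inj_eq val_inj) eq_sym (negPf vw) /GRing.scale /= mulr0.
- exists (n + leaves r)%N; exact: (stable_comp sF (stable_NodeL _ o r)).
- exists (leaves l + n)%N; exact: (stable_comp sF (stable_NodeR _ o l)).
Qed.

Lemma monomial_neq n s : leaves s != n -> monomial K n s = 0.
Proof.
move=> sn; apply/ffunP=> u; rewrite !ffunE; case: eqP => // us.
by rewrite -us (eqP (valP u)) eqxx in sn.
Qed.

(** If [p] is not the arity of the results, all monomials involved are zero. *)
Lemma stable_ideal m n p phi (f : free_op K m) : stable m n phi ->
  generated_ideal R f -> generated_ideal R (lin (fun u => monomial K p (phi u)) f).
Proof.
move=> [phin sphi] If; have [->|pn] := eqVneq p n; first exact: sphi.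
rewrite (@lin_ext _ _ _ (fun=> 0)) => [|u um]; last first.
  by rewrite monomial_neq // phin // eq_sym.
by rewrite /lin big1 => [|u _]; [exact: (ideal0 idR)|rewrite scaler0].
Qed.

End IdealClosure.

Lemma quotv_pi_eq0 (K : fieldType) (V : vectType K) (S : submodClosed V) v :
  (quotv_pi S v == 0) = (v \in S).
Proof. by rewrite -(linear0 (quotv_pi S)) quotv_pi_eq subr0. Qed.

Lemma quotv_compat (K : fieldType) n :
  compat (fun s => quotv_pi (@in_ideal K (relators (-1)) n) (monomial K n s)).
Proof.
move=> F a b c k.
pose R := relators (-1 : K).
(* Grafting from right to left keeps the numbers of the remaining leaves. *)
pose args u := graft (graft (graft u 2 c) 1 b) 0 a.
have [q sq] : exists q, stable R 3 q (fun u => plug F (args u)).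
  pose p := (((3 + leaves c).-1 + leaves b).-1 + leaves a).-1.
  have [q sF] := stable_plug R p F; exists q.
  have lc := leaves_gt0 c; have lb := leaves_gt0 b.
  apply: stable_comp sF; apply: stable_comp (stable_graft _ _ _); last by lia.
  by apply: stable_comp (stable_graft _ _ _); [apply: stable_graft|lia].
pose phi u := monomial K n (plug F (args u)).
pose f : {additive free_op K 3 -> free_op K n} := lin phi.
have fk : (relvals (fun o1 o2 => f (lmon K o1 o2)) (fun o1 o2 => f (rmon K o1 o2)))`_k
    \in @in_ideal K R n.
  rewrite -map_relvals -relators_relvals nth_map_raddf.
  have [ltk|gek] := ltnP k (size R); last by rewrite nth_default // (raddf0 f) rpred0.
  apply/asboolP; apply: (stable_ideal _ sq).
  by apply: generated_ideal_gen; rewrite mem_nth.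
move: fk; rewrite -quotv_pi_eq0 => /eqP fk; rewrite -[RHS]fk.
rewrite -(nth_map_raddf (quotv_pi _)) map_relvals.
congr ((relvals _ _)`_k); apply/funext=> o1; apply/funext=> o2;
  by rewrite /f /= lin_monomial.
Qed.

(** * Counting binary trees *)

Definition join_roots (f : seq btree) : seq btree :=
  if f is [:: l, r & f'] then BN l r :: f' else f.

(* The forests of k trees with m nodes in total: the first tree is empty, or  *)
(* removing its root leaves a forest of k + 1 trees.                          *)
Fixpoint forests (m : nat) : nat -> seq (seq btree) :=
  fix forests_m k := match k with
  | 0 => if m is 0 then [:: [::]] else [::]
  | k'.+1 => map (cons BL) (forests_m k') ++
             (if m is m'.+1 then map join_roots (forests m' k'.+2) else [::])
  end%N.

Lemma forests_S m k : forests m k.+1 = map (cons BL) (forests m k) ++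
  (if m is m'.+1 then map join_roots (forests m' k.+2) else [::]).
Proof. by case: m. Qed.

Lemma mem_forests m k f :
  (f \in forests m k) = (size f == k) && (sumn (map nodes f) == m).
Proof.
elim: m k f => [|m IHm]; elim=> [|k IHk] f.
- by rewrite inE; case: f.
- rewrite forests_S cats0; apply/mapP/idP=> [[f' + ->]|].
    by rewrite IHk.
  by case: f => // -[|l r] f /= fk; [exists f; rewrite ?IHk|rewrite andbF in fk].
- by case: f.
- rewrite forests_S mem_cat; apply/orP/idP=> [[/mapP[f' + ->]|/mapP[f' + ->]]|].
  + by rewrite IHk.
  + rewrite IHm; case: f' => [|l [|r f']] //= /andP[/eqP fk /eqP fm].
    by apply/andP; split; apply/eqP; lia.
  case: f => // -[|l r] f /= fP; [left|right]; apply/mapP.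
    by exists f; rewrite ?IHk.
  by exists [:: l, r & f]; rewrite ?IHm //= addnA.
Qed.

Lemma forests_uniq m k : uniq (forests m k).
Proof.
elim: m k => [|m IHm]; elim=> [|k IHk] //; rewrite forests_S ?cats0.
  by rewrite map_inj_uniq // => f g [].
rewrite cat_uniq map_inj_uniq ?IHk /=; last by move=> f g [].
apply/andP; split.
  apply/hasPn=> _ /mapP[f + ->]; rewrite mem_forests.
  by case: f => [|l [|r f]] //= _; apply/mapP=> -[].
rewrite map_inj_in_uniq // => f g; rewrite !mem_forests.
by case: f => [|l [|r f]] //= _; case: g => [|l' [|r' g]] //= _ [-> -> ->].
Qed.

Lemma size_forests0 k : size (forests 0 k) = 1%N.
Proof. by elim: k => //= k IH; rewrite cats0 size_map. Qed.

(** Ballot numbers: for M = m + 1 nodes the count is C(2M + k - 1, M) - C(2M + k - 1, M - 1), and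
    the recursion is Pascal's rule. For k = 0 both binomials agree by symmetry. *)
Lemma size_forests m k :
  (size (forests m.+1 k) + 'C((m.*2 + k).+1, m) = 'C((m.*2 + k).+1, m.+1))%N.
Proof.
elim: m k => [|m IHm]; elim=> [|k IHk].
- by [].
- rewrite forests_S size_cat !size_map size_forests0.
  by move: IHk; rewrite !bin0 !bin1; lia.
- by rewrite addn0 -bin_sub; [congr ('C(_, _))|]; lia.
rewrite forests_S size_cat !size_map.
have := IHm k.+2; move: IHk; rewrite (_ : m.*2 + k.+2 = m.+1.*2 + k)%N; last by lia.
by rewrite addnS !binS; lia.
Qed.

Definition btrees n := map (head BL) (forests n 1).

Lemma mem_btrees n b : (b \in btrees n) = (nodes b == n).
Proof.
apply/mapP/idP=> [[f + ->]|bn].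
  by rewrite mem_forests; case: f => [|c [|]] //=; rewrite addn0.
by exists [:: b]; rewrite // mem_forests /= addn0.
Qed.

Lemma btrees_uniq n : uniq (btrees n).
Proof.
rewrite map_inj_in_uniq ?forests_uniq // => f g; rewrite !mem_forests.
by case: f => [|c [|]] //= _; case: g => [|d [|]] //= _ ->.
Qed.

(** The Catalan number is C(2n, n) - C(2n, n - 1), and n C(2n, n) = (n + 1) C(2n, n - 1). *)
Lemma size_btrees n : (0 < n)%N -> (n * size (btrees n) = 'C(2 * n, n.-1))%N.
Proof.
case: n => // n _; rewrite size_map succnK.
have := size_forests n 1; have := mul_bin_left (n.*2 + 1).+1 n.
rewrite (_ : (n.*2 + 1).+1 = 2 * n.+1)%N; last by lia.
rewrite (_ : 2 * n.+1 - n = n.+2)%N; last by lia.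
set B := 'C(_, n.+1); set B' := 'C(_, n); set s := size _ => /= BB' sB.
by apply/eqP; rewrite -(eqn_add2r (n.+1 * B')) -mulnDr sB BB'; apply/eqP; lia.
Qed.

(** * The basis *)

Lemma quotv_pi_surj (K : fieldType) (V : vectType K) (S : submodClosed V)
  (q : quotv S) : exists v, q = quotv_pi S v.
Proof.
by exists (repr (q : Quotient.quot (quotv_ker S))); rewrite /quotv_pi reprK.
Qed.

Section Basis.
Variables (K : realFieldType) (n : nat).
Hypotheses (n_gt0 : (0 < n)%N) (n_neq3 : n <> 3).

Let pi := quotv_pi (@in_ideal K (relators (-1)) n).

Definition std_index := [seq (b, j) | b <- btrees n, j <- iota 0 n].

Definition std_vectors : seq (Xminus K n) :=
  [seq pi (monomial K n (mark (std p.1) p.2)) | p <- std_index].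

Lemma std_indexP p : reflect (nodes p.1 = n /\ (p.2 < n)%N) (p \in std_index).
Proof.
apply: (iffP allpairsP) => [[[b j] [/= + + ->]]|[bn jn]].
  by rewrite mem_btrees mem_iota => /eqP.
by exists p; case: p bn jn => b j /= /eqP bn jn; rewrite mem_btrees mem_iota.
Qed.

Lemma std_index_uniq : uniq std_index.
Proof. by apply: allpairs_uniq; rewrite ?btrees_uniq ?iota_uniq // => -[? ?] [? ?]. Qed.

Lemma leaves_mark_std p : p \in std_index -> leaves (mark (std p.1) p.2) = n.
Proof. by case/std_indexP=> pn _; rewrite leaves_mark leaves_std pn; lia. Qed.

Lemma std_vectors_free : free std_vectors.
Proof.
pose p0 := (BL, 0%N); rewrite -[std_vectors]/(tval (in_tuple std_vectors)).
apply/freeP=> k k0 i.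
have szE : size std_vectors = size std_index by rewrite size_map.
pose q (i : 'I_(size std_vectors)) := nth p0 std_index i.
have qP i' : q i' \in std_index by rewrite mem_nth // -szE.
pose f : free_op K n :=
  \sum_(i' < size std_vectors) k i' *: monomial K n (mark (std (q i').1) (q i').2).
have /eqP : pi f = 0.
  rewrite -[RHS]k0 /pi /f linear_sum; apply: eq_bigr => i' _.
  by rewrite linearZ /= (nth_map p0) // -szE.
rewrite quotv_pi_eq0 => /asboolP If.
(* This functional descends to the quotient and is dual to the vector of index [i], so it extracts
   [k i]. *)
pose h : tree -> K^o := coeff K (q i).1 (q i).2.
have := compat_generated_ideal (eval_compat _ _ : compat h) If.
rewrite /f linear_sum (bigD1 i) //= linearZ /= lin_monomial leaves_mark_std // eqxx.
have [qin qij] := std_indexP _ (qP i).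
rewrite /h coeff_mark_std // ?qin // !eqxx big1 => [|i' i'i]; last first.
  have [qi'n qi'j] := std_indexP _ (qP i').
  rewrite linearZ /= lin_monomial leaves_mark_std // eqxx coeff_mark_std ?qi'n ?qin //.
  have /negPf : q i' != q i.
    by rewrite /q nth_uniq ?std_index_uniq // -szE.
  by rewrite -pair_eqE /pair_eq => ->; rewrite scaler0.
by rewrite addr0 /GRing.scale /= mulr1.
Qed.

(** [P] projects onto a complement of the span. Each coordinate of [P] after the quotient map is a
    compatible function vanishing on the standard trees, hence zero by [compat_vanish]. *)
Lemma std_vectors_span : (<<std_vectors>> = fullv)%VS.
Proof.
set U := (<<_>>)%VS; pose P := daddv_pi U^C%VS U.
have cap : (U :&: U^C = 0)%VS by exact: capv_compl.
have decomp v : v = daddv_pi U U^C%VS v + P v.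
  by rewrite daddv_pi_add // addv_complf memvf.
have P0 v : v \in U -> P v = 0.
  move=> vU; have := decomp v; rewrite daddv_pi_id // => /eqP.
  by rewrite -subr_eq0 opprD addNKr oppr_eq0 => /eqP.
suff Pmono s : leaves s = n -> P (pi (monomial K n s)) = 0.
  apply/vspaceP=> v; rewrite memvf (decomp v) rpredD ?memv_pi //.
  have [f ->] := quotv_pi_surj v.
  have -> : f = \sum_u (f u : K) *: monomial K n (val u).
    apply/ffunP=> w; rewrite sum_ffunE (bigD1 w) //= big1 ?addr0 => [|u uw].
      by rewrite !ffunE eqxx /GRing.scale /= mulr1.
    by rewrite !ffunE (inj_eq val_inj) eq_sym (negPf uw) /GRing.scale /= mulr0.
  rewrite /pi !linear_sum rpred_sum // => u _.
  by rewrite !linearZ /= -/pi Pmono ?scaler0 ?rpred0 // (eqP (valP u)).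
move=> sn; rewrite (coord_vbasis (memvf (P _))) big1 // => i _.
pose h s : K := coord (vbasis fullv) i (P (pi (monomial K n s))).
suff -> : coord (vbasis fullv) i (P (pi (monomial K n s))) = 0 by rewrite scale0r.
rewrite -/(h s); apply: (@compat_vanish _ _ n) => // [|u u3|b j bn jn].
- exact: (compat_comp (coord (vbasis fullv) i) (compat_comp P (@quotv_compat K n))).
(* As n is not 3, a tree with three leaves has zero monomial in arity [n]. *)
- rewrite /h /pi monomial_neq ?linear0 // u3; apply/eqP => n3; exact: n_neq3.
- rewrite /h P0 ?linear0 // memv_span //; apply/mapP; exists (b, j) => //.
  exact/std_indexP.
Qed.

Lemma dim_Xminus : \dim (fullv : {vspace Xminus K n}) = 'C(2 * n, n.-1).
Proof.
rewrite -std_vectors_span (eqP std_vectors_free) size_map size_allpairs size_iota.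
by rewrite mulnC size_btrees.
Qed.
End Basis.

Theorem theorem3p1 (n : nat) (n_ge1 : (1 <= n)%N) (n_neq3 : n <> 3) :
  \dim (fullv : {vspace Xminus rat n}) = 'C(2 * n, n.-1).
Proof. exact: dim_Xminus. Qed.
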